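(* Let $A$ and $B$ be unital complex Banach algebras such that $A$ is a subalgebra of $B$ and the unit of $B$ lies in $A$. Assume that $A$ is inverse closed in $B$ and that $A$ is continuously embedded in $B$. Let $n\ge 1$. If $T\in U_n^e(A)$ (or $T\in L_n^e(A)$) and $T$ is invertible in $M_n(B)$, i.e. $T^{-1}\in M_n(B)$, then $T^{-1}\in M_n(A)$.
   Context: $A$ and $B$ carry their own complete Banach algebra norms $\|\cdot\|_A$, $\|\cdot\|_B$. $A$ is inverse closed in $B$ if whenever $a\in A$ is invertible in $B$, then $a^{-1}\in A$. $A$ is continuously embedded in $B$ if there exists $J>0$ such that $J\|a\|_A\ge\|a\|_B$ for all $a\in A$. $M_n(D)$ denotes the algebra of all $n\times n$ matrices with entries from $D$. A two-sided ideal of $A$ is called inessential if for each of its elements $a$ the spectrum $\sigma(a;A)$ of $a$ relative to $A$ is either a finite set or a sequence converging to $0$ (i.e. $0$ is the only possible accumulation point of the spectrum). $I(A)$ denotes the largest inessential ideal of $A$ (it is a known fact that such a largest ideal exists). A matrix $T=(t_{jk})\in M_n(A)$ is in $U_n^e(A)$ if $t_{jk}\in I(A)$ whenever $j>k$; it is in $L_n^e(A)$ if $t_{jk}\in I(A)$ whenever $j<k$. *)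

(* Defs.v *)
From HB Require Import structures.
From mathcomp Require Import all_boot all_order all_algebra.
From mathcomp Require Import complex.
From mathcomp Require Import all_classical all_reals all_analysis.

Set Implicit Arguments.
Unset Strict Implicit.
Unset Printing Implicit Defensive.

Import Order.TTheory GRing.Theory Num.Theory.
Import numFieldNormedType.Exports.

Local Open Scope classical_set_scope.
Local Open Scope ring_scope.

(* The ring structure is added by hand on top of [completeNormedModType]: an
   [HB.structure] joining it with [GRing.Algebra] is rejected, because the
   library declares [Num.NumDomain] without the corresponding join.
   As for every normed module over K, the norm takes its values in K itself;
   for K = R[i] these values are nonnegative reals, since 0 <= z forces z to be
   real.  The normalisation `|1| = 1 is not imposed. *)
Record banachAlgType (K : numFieldType) := BanachAlgebra {
  banach_space : completeNormedModType K;
  bmul : banach_space -> banach_space -> banach_space;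
  bone : banach_space;
  bmulA : associative bmul;
  bmul1r : left_id bone bmul;
  bmulr1 : right_id bone bmul;
  bmulDl : left_distributive bmul +%R;
  bmulDr : right_distributive bmul +%R;
  bone_neq0 : bone != 0;
  bscaleAl : forall (k : K) x y, k *: bmul x y = bmul (k *: x) y;
  bscaleAr : forall (k : K) x y, k *: bmul x y = bmul x (k *: y);
  bnormM : forall x y, `|bmul x y| <= `|x| * `|y|
}.

Definition banach_sort (K : numFieldType) (A : banachAlgType K) : Type :=
  banach_space A.
Coercion banach_sort : banachAlgType >-> Sortclass.

HB.instance Definition _ (K : numFieldType) (A : banachAlgType K) :=
  CompleteNormedModule.copy (banach_sort A) (banach_space A).
HB.instance Definition _ (K : numFieldType) (A : banachAlgType K) :=
  GRing.Zmodule_isNzRing.Build (banach_sort A) (@bmulA K A) (@bmul1r K A)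
    (@bmulr1 K A) (@bmulDl K A) (@bmulDr K A) (@bone_neq0 K A).
HB.instance Definition _ (K : numFieldType) (A : banachAlgType K) :=
  GRing.Lmodule_isLalgebra.Build K (banach_sort A) (@bscaleAl K A).
HB.instance Definition _ (K : numFieldType) (A : banachAlgType K) :=
  GRing.Lalgebra_isAlgebra.Build K (banach_sort A) (@bscaleAr K A).

Lemma normrM_le (K : numFieldType) (A : banachAlgType K) (x y : A) :
  `|x * y| <= `|x| * `|y|.
Proof. exact: bnormM. Qed.

(* [GRing.unit] is not available: matrices over a noncommutative ring carry no
   [unitRingType] structure. *)
Definition is_inverse (D : pzRingType) (x y : D) : Prop :=
  x * y = 1 /\ y * x = 1.

Definition invertible (D : pzRingType) (x : D) : Prop :=
  exists y, is_inverse x y.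

Section Inessential.
Variables (R : realType) (A : banachAlgType R[i]).

Definition spectrum (a : A) : set R[i] :=
  [set z | ~ invertible (z%:A - a)].

Definition two_sided_ideal (J : set A) : Prop :=
  [/\ J 0,
      forall x y, J x -> J y -> J (x + y),
      forall a x, J x -> J (a * x)
    & forall a x, J x -> J (x * a)].

Definition inessential (J : set A) : Prop :=
  two_sided_ideal J /\
  forall a, J a -> limit_point (spectrum a : set R[i]^o) `<=` [set 0].

Definition largest_inessential (I : set A) : Prop :=
  inessential I /\ forall J, inessential J -> J `<=` I.

(* The largest inessential ideal, as the union of all of them; see
   [largest_inessentialE]. *)
Definition inessential_radical : set A :=
  \bigcup_(J in [set J | inessential J]) J.

Lemma largest_inessentialE (I : set A) :
  largest_inessential I -> inessential_radical = I.
Proof.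
move=> [inI maxI]; apply/seteqP; split=> [x [J /= /maxI sJI /sJI] //|x Ix].
by exists I.
Qed.

Definition ess_upper n (T : 'M[A]_n) : Prop :=
  forall j k : 'I_n, (k < j)%N -> inessential_radical (T j k).

Definition ess_lower n (T : 'M[A]_n) : Prop :=
  forall j k : 'I_n, (j < k)%N -> inessential_radical (T j k).

End Inessential.

(* A is viewed inside B through an injective unital algebra morphism iota. *)
Section Embedding.
Variables (R : realType) (A B : banachAlgType R[i]).
Variable iota : {lrmorphism A -> B}.

Definition inverse_closed : Prop :=
  forall (a : A) (b : B), is_inverse (iota a) b -> range iota b.

Definition continuously_embedded : Prop :=
  exists2 J : R, 0 < J & forall a : A, `|iota a| <= J%:C%C * `|a|.

End Embedding.

(* Main.v *)
Require Import Defs.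
From HB Require Import structures.
From mathcomp Require Import all_boot all_order all_fingroup all_algebra.
From mathcomp Require Import complex.
From mathcomp Require Import all_classical all_reals all_analysis.

Import Order.TTheory GRing.Theory Num.Theory.
Import numFieldNormedType.Exports.
Local Open Scope ring_scope.

Set Implicit Arguments.
Unset Strict Implicit.
Unset Printing Implicit Defensive.

(** Changing one entry of a matrix T over A by s replaces T by T + s E_ij, where
    E_ij is a matrix unit.  If T has inverse S, this rank-one change is
    invertible exactly when the ring element 1 + S_ji s is
    ([invertible_update]).  So a question about matrices becomes one about
    elements, and for elements A is inverse closed in B: whenever T and
    T + s E_ij are both invertible over B, an inverse of T + s E_ij over A yields
    an inverse of T over A ([reflects_units_update]).  One may therefore change
    entries of T at will, as long as T stays invertible over B.

    Let T be upper triangular modulo inessential elements.  The entry in the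
    second row of the first column is inessential, hence a limit of invertible
    elements of A ([ess_sum_closure]): its spectrum cannot fill a neighbourhood
    of a nonzero point.  A small change of that entry makes it invertible in A
    while T stays invertible over B, by the Neumann series in B.  With this entry
    as pivot, the Schur complement removes the first column and the second row.
    The remaining matrix is one size smaller and again upper triangular modulo
    inessential elements, since the pivot lies just below the diagonal.  Induction
    on the size ends at 1 x 1 matrices, where inverse closedness is the claim
    ([reflects_units_upper_triangular]).  Reversing the order of the indices turns
    the lower triangular case into the upper triangular one.

    The Schur complement mixes entries that may belong to different inessential
    ideals.  That a sum of inessential ideals is inessential is a substantial
    theorem, which is avoided here: the argument runs on finite sums of
    inessential elements, and only their approximation by invertible elements
    enters. *)

(** * Invertible matrices over a noncommutative ring *)

Lemma is_inverse_unique (D : pzRingType) (x y z : D) :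
  is_inverse x y -> is_inverse x z -> y = z.
Proof. by move=> [_ yx] [xz _]; rewrite -[y]mulr1 -xz mulrA yx mul1r. Qed.

Lemma invertibleM (D : pzRingType) (x y : D) :
  invertible x -> invertible y -> invertible (x * y).
Proof.
move=> [x' [xx' x'x]] [y' [yy' y'y]]; exists (y' * x'); split.
  by rewrite mulrA -(mulrA x) yy' mulr1.
by rewrite mulrA -(mulrA y') x'x mulr1.
Qed.

Lemma invertibleMl (D : pzRingType) (x y : D) :
  invertible x -> invertible (x * y) <-> invertible y.
Proof.
move=> [x' [xx' x'x]]; split=> [xy|]; last by apply: invertibleM; exists x'.
rewrite -[y]mul1r -x'x -mulrA; apply: invertibleM => //; by exists x.
Qed.

Lemma invertibleMr (D : pzRingType) (x y : D) :
  invertible y -> invertible (x * y) <-> invertible x.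
Proof.
move=> [y' [yy' y'y]]; split=> [xy|xi]; last by apply: invertibleM => //; exists y'.
rewrite -[x]mulr1 -yy' mulrA; apply: invertibleM => //; by exists y.
Qed.

Lemma invertible_mx11 (D : pzRingType) (a : D) :
  invertible (a%:M : 'M[D]_1) <-> invertible a.
Proof.
split=> [[Y [aY Ya]]|[b [ab ba]]]; last first.
  by exists b%:M; split; rewrite -[_ * _]scalar_mxM ?ab ?ba.
exists (Y 0 0); split.
  by move/matrixP/(_ 0 0): aY; rewrite !mxE big_ord1 !mxE mulr1n.
by move/matrixP/(_ 0 0): Ya; rewrite !mxE big_ord1 !mxE mulr1n.
Qed.

(** The witness comes from the formal expansion of the inverse of 1 + vu:
    1 - vu + vuvu - ... = 1 - v (1 - uv + uvuv - ...) u. *)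
Lemma sylvester_invertible (D : pzRingType) (m n : nat)
    (u : 'M[D]_(n, m)) (v : 'M[D]_(m, n)) :
  invertible (1 + u *m v) -> invertible (1 + v *m u).
Proof.
move=> [W [uvW Wuv]]; exists (1 - v *m W *m u).
have e1 : u *m v *m W = 1 - W by rewrite -uvW mulrDl mul1r addrAC subrr add0r.
have e2 : W *m (u *m v) = 1 - W by rewrite -Wuv mulrDr mulr1 addrAC subrr add0r.
split.
  rewrite mulrDl mul1r mulrDr mulr1 mulrN.
  have -> : v *m u * (v *m W *m u) = v *m u - v *m W *m u.
    rewrite -[_ * _]/(_ *m _) !mulmxA -(mulmxA v u) -(mulmxA v) e1.
    by rewrite mulmxBr mulmxBl mulmx1.
  by rewrite opprB [_ + (_ - _)]addrC subrK subrK.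
rewrite mulrDr mulr1 mulrBl mul1r.
have -> : v *m W *m u * (v *m u) = v *m u - v *m W *m u.
  rewrite -[_ * _]/(_ *m _) -!mulmxA (mulmxA u) (mulmxA W) e2.
  by rewrite mulmxBl mulmxBr mul1mx.
by rewrite opprB [_ + (_ - _)]addrC subrK subrK.
Qed.

(** T + s E_ij = T (1 + S u v) with u the column e_i s and v the row e_j, so
    Sylvester's exchange reduces invertibility to that of the 1 x 1 matrix
    1 + v S u. *)
Lemma invertible_update (D : pzRingType) (n : nat) (T S : 'M[D]_n)
    (i j : 'I_n) (s : D) :
  is_inverse T S ->
  invertible (T + s *: delta_mx i j) <-> invertible (1 + S j i * s).
Proof.
move=> [TS ST].
pose u : 'M[D]_(n, 1) := delta_mx i 0 *m s%:M.
pose v : 'M[D]_(1, n) := delta_mx 0 j.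
have -> : s *: delta_mx i j = u *m v.
  apply/matrixP => a b; rewrite !mxE big_ord1 !mxE big_ord1 !mxE /= !eqxx /=.
  by case: (a == i); case: (b == j);
    rewrite /= ?mulr1n ?mulr0 ?mul0r ?mulr1 ?mul1r.
have -> : T + u *m v = T * (1 + (S *m u) *m v).
  by rewrite mulrDr mulr1 -[T * _]/(T *m _) !mulmxA -[T *m S]/(T * S) TS mul1mx.
have E : 1 + v *m (S *m u) = (1 + S j i * s)%:M.
  rewrite !mulmxA -rowE -colE raddfD /= scalar_mxM; congr (_ + _ *m _).
  by rewrite [LHS]mx11_scalar !mxE.
have Ti : invertible T by exists S.
rewrite (invertibleMl _ Ti); apply: (iff_trans _ (invertible_mx11 _)).
by rewrite -E; split; exact: sylvester_invertible.
Qed.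

(** Block Gaussian elimination: T is the product of a lower unitriangular matrix,
    the block diagonal matrix of the pivot and the Schur complement, and an upper
    unitriangular matrix. *)
Lemma invertible_schur (D : pzRingType) (n : nat) (T : 'M[D]_(1 + n))
    (q : 'M[D]_1) :
  is_inverse (ulsubmx T) q ->
  invertible T <->
  invertible (drsubmx T - dlsubmx T *m q *m ursubmx T : 'M[D]_n).
Proof.
set p := ulsubmx T; set v := ursubmx T; set u := dlsubmx T; set M := drsubmx T.
move=> [pq qp]; set C := M - _.
pose L : 'M[D]_(1 + n) := block_mx 1 0 (u *m q) 1.
pose U : 'M[D]_(1 + n) := block_mx 1 (q *m v) 0 1.
pose B : 'M[D]_(1 + n) := block_mx p 0 0 C.
have Li : invertible L.
  exists (block_mx 1 0 (- (u *m q)) 1).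
  by split; rewrite -[_ * _]/(_ *m _) mulmx_block !(mul1mx, mulmx1, mul0mx,
    mulmx0, addr0, add0r) ?addNr ?subrr -scalar_mx_block.
have Ui : invertible U.
  exists (block_mx 1 (- (q *m v)) 0 1).
  by split; rewrite -[_ * _]/(_ *m _) mulmx_block !(mul1mx, mulmx1, mul0mx,
    mulmx0, addr0, add0r) ?addNr ?subrr -scalar_mx_block.
have TE : T = L * B * U.
  rewrite -[_ * _]/(_ *m _ *m _) !mulmx_block !(mul1mx, mulmx1, mul0mx,
    mulmx0, addr0, add0r) mulmxA -(mulmxA u) -[p *m q]/(p * q) pq.
  rewrite -[q *m p]/(q * p) qp mul1mx mulmx1 mulmxA addrC subrK.
  by rewrite submxK.
rewrite TE (invertibleMr _ Ui) (invertibleMl _ Li).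
split=> [[Y [BY YB]]|[Z [CZ ZC]]].
  rewrite -[_ * _]/(_ *m _) -(submxK Y) mulmx_block in BY.
  rewrite -[_ * _]/(_ *m _) -(submxK Y) mulmx_block in YB.
  rewrite -[RHS]/(1%:M) scalar_mx_block in BY.
  rewrite -[RHS]/(1%:M) scalar_mx_block in YB.
  exists (drsubmx Y); split.
    by case/eq_block_mx: BY => _ _ _; rewrite mul0mx add0r.
  by case/eq_block_mx: YB => _ _ _; rewrite mulmx0 add0r.
exists (block_mx q 0 0 Z).
split; rewrite -[_ * _]/(_ *m _) mulmx_block !(mul1mx, mulmx1, mul0mx,
    mulmx0, addr0, add0r).
  by rewrite -[p *m q]/(p * q) -[C *m Z]/(C * Z) pq CZ -scalar_mx_block.
by rewrite -[q *m p]/(q * p) -[Z *m C]/(Z * C) qp ZC -scalar_mx_block.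
Qed.

(** The correction term is written as an entry of the first column times a ring
    element, so that it stays in any right ideal containing that entry. *)
Lemma schur_entry (D : pzRingType) (n : nat) (T : 'M[D]_(1 + n)) (q : 'M[D]_1)
    (i j : 'I_n) :
  (drsubmx T - dlsubmx T *m q *m ursubmx T) i j =
  T (rshift 1 i) (rshift 1 j) +
  T (rshift 1 i) (lshift n 0) * - (q 0 0 * T (lshift n 0) (rshift 1 j)).
Proof. by rewrite !mxE big_ord1 !mxE big_ord1 !mxE mulrN mulrA. Qed.

Lemma invertible_perm_mx (D : pzRingType) (n : nat) (s : 'S_n) :
  invertible (perm_mx s : 'M[D]_n).
Proof.
exists (perm_mx s^-1).
by split; rewrite -[_ * _]/(_ *m _) -perm_mxM ?mulgV ?mulVg perm_mx1.
Qed.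

Lemma invertible_row_perm (D : pzRingType) (n : nat) (s : 'S_n) (T : 'M[D]_n) :
  invertible (row_perm s T) <-> invertible T.
Proof. by rewrite row_permE; apply: invertibleMl; exact: invertible_perm_mx. Qed.

Lemma invertible_col_perm (D : pzRingType) (n : nat) (s : 'S_n) (T : 'M[D]_n) :
  invertible (col_perm s T) <-> invertible T.
Proof. by rewrite col_permE; apply: invertibleMr; exact: invertible_perm_mx. Qed.

(** * Morphisms that reflect units *)

Definition reflects_units (D E : pzRingType) (f : D -> E) : Prop :=
  forall a, invertible (f a) -> invertible a.

(** T is itself a one-entry update of the matrix T + s E_ij.  Over both rings its
    invertibility is that of one element, and f reflects units. *)
Lemma reflects_units_update (D E : pzRingType) (f : {rmorphism D -> E}) (n : nat)
    (T : 'M[D]_n) (i j : 'I_n) (s : D) :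
  reflects_units f -> invertible (map_mx f T) ->
  invertible (T + s *: delta_mx i j) -> invertible T.
Proof.
move=> fR fT; set T' := T + _ => -[S T'S].
have TE : T = T' + (- s) *: delta_mx i j by rewrite scaleNr addrK.
rewrite TE (invertible_update _ _ _ T'S).
apply: fR; rewrite rmorphD rmorph1 rmorphM.
have fT'S : is_inverse (map_mx f T') (map_mx f S).
  by case: T'S => T'S ST'; split; rewrite -[_ * _]map_mxM -?[_ *m _]/(_ * _)
    ?T'S ?ST' map_mx1.
have <- : map_mx f S j i = f (S j i) by rewrite mxE.
rewrite -(invertible_update _ _ _ fT'S).
by rewrite -(map_delta_mx f) -map_mxZ -map_mxD -TE.
Qed.

(** The analysis enters only through the last hypothesis on K: any x in K can be
    made invertible by adding some s, and for a matrix over E with inverse S and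
    b = S_ji, invertibility of 1 + b f(s) says that adding f(s) at the entry
    (i, j) keeps the matrix invertible. *)
Lemma reflects_units_upper_triangular (D E : nzRingType) (f : {rmorphism D -> E})
    (K : D -> Prop) :
  reflects_units f ->
  (forall x y, K x -> K y -> K (x + y)) ->
  (forall x a, K x -> K (x * a)) ->
  (forall x b, K x -> exists s, invertible (x + s) /\ invertible (1 + b * f s)) ->
  forall n (T : 'M[D]_n.+1), (forall i j : 'I_n.+1, (j < i)%N -> K (T i j)) ->
  invertible (map_mx f T) -> invertible T.
Proof.
move=> fR KD KM Kpert; elim=> [|n IH] T TK fT.
  rewrite [T]mx11_scalar; apply/invertible_mx11/fR/invertible_mx11.
  by rewrite -map_scalar_mx -mx11_scalar.
have [S fTS] := fT.
pose i1 : 'I_n.+2 := lift 0 0.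
have [s [Ts bs]] := Kpert (T i1 0) (S 0 i1) (TK i1 0 isT).
pose T1 := T + s *: delta_mx i1 0.
have fT1 : invertible (map_mx f T1).
  rewrite /T1 map_mxD map_mxZ map_delta_mx.
  by rewrite (invertible_update _ _ _ fTS).
suff : invertible T1 by move/(reflects_units_update fR fT).
have T1E (i j : 'I_n.+2) : (j < i)%N -> (1 < i)%N -> K (T1 i j).
  move=> ji i2; rewrite !mxE.
  have -> : (i == i1) = false by apply/eqP => i_1; rewrite i_1 in i2.
  by rewrite /= mulr0 addr0; exact: TK.
(* The swap of the first two rows brings the pivot to the corner. *)
apply/(invertible_row_perm (tperm 0 i1)).
pose T2 : 'M[D]_(1 + n.+1) := row_perm (tperm 0 i1) T1.
have fT2 : invertible (map_mx f T2).
  by rewrite map_row_perm; apply/invertible_row_perm.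
have : invertible (ulsubmx T2).
  rewrite [ulsubmx _]mx11_scalar; apply/invertible_mx11.
  by rewrite !mxE !lshift0 tpermL !eqxx mulr1.
move=> [q [T2q qT2]].
have T2q' : is_inverse (ulsubmx T2) q by [].
rewrite -/T2; apply/(invertible_schur T2q'); apply: IH; last first.
  have fq : is_inverse (ulsubmx (map_mx f T2)) (map_mx f q).
    by split; rewrite -map_ulsubmx -[_ * _]map_mxM -?[_ *m _]/(_ * _)
      ?T2q ?qT2 map_mx1.
  rewrite map_mxB !map_mxM map_drsubmx map_dlsubmx map_ursubmx.
  by apply/(invertible_schur fq).
move=> i j ji.
have i0 : (0 < i)%N by exact: leq_ltn_trans ji.
(* Rows of the Schur complement below its first one come from rows of T1 that the
   swap does not move; the first one imposes no condition. *)
have row2 k : T2 (rshift 1 i) k = T1 (rshift 1 i) k.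
  rewrite !mxE tpermD //; apply/eqP => /(congr1 val) //=.
  by case=> i_0; move: i0; rewrite -[i : nat]i_0.
rewrite schur_entry !row2; apply: KD; first exact: T1E.
by apply: KM; exact: T1E.
Qed.

(** * Small perturbations of the unit in a Banach algebra *)

Lemma halving_lt (R : realType) (c e : R[i]) :
  0 <= c -> 0 < e -> exists N, c / 2 ^+ N < e.
Proof.
move=> c0 e0; have ce0 : 0 <= c / e by rewrite divr_ge0 // ltW.
have [t tE] := complex_realP _ (ger0_real ce0).
exists (Num.truncn t).+1.
rewrite ltr_pdivrMr ?exprn_gt0 // mulrC -ltr_pdivrMr // tE.
have t0 : 0 <= t by rewrite -lecR -tE.
apply: (@lt_le_trans _ _ ((Num.truncn t).+1%:R)).
  by rewrite -(rmorph_nat (@real_complex R)) ltcR truncnS_gt.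
by rewrite -natrX ler_nat ltnW // ltn_expl.
Qed.

(** The partial sums of the Neumann series satisfy y_(n+1) = 1 + x y_n, which is
    also 1 + y_n x.  Both maps are contractions, so the limit is a fixed point
    of each, which says that it is a two-sided inverse of 1 - x.  With the bound
    1/2, consecutive differences of the y_n are halved at each step, and it is
    enough that negative powers of 2 tend to 0. *)
Lemma neumann_invertible (R : realType) (B : banachAlgType R[i]) (x : B) :
  `|x| <= 2^-1 -> invertible (1 - x).
Proof.
move=> x2.
pose y := fix y n : B := if n is m.+1 then 1 + x * y m else 0.
have yS n : y n.+1 = 1 + x * y n by [].
have yC n : x * y n = y n * x.
  by elim: n => [|n IH]; rewrite ?mulr0 ?mul0r // yS mulrDr mulrDl mulr1 mul1r
    -mulrA -IH.
have xle z : `|x * z| <= `|z| / 2.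
  by apply: (le_trans (normrM_le _ _)); rewrite mulrC ler_wpM2l.
have y_bounded n : `|y n| <= `|1 : B| * 2.
  elim: n => [|n IH]; first by rewrite normr0 mulr_ge0.
  rewrite yS (le_trans (ler_normD _ _)) // mulr_natr mulr2n lerD2l.
  by rewrite (le_trans (xle _)) // ler_pdivrMr.
have y_cauchy N m : `|y (N + m)%N - y N| <= (`|1 : B| * 2) / 2 ^+ N.
  elim: N => [|N IH]; first by rewrite add0n subr0 expr0 divr1.
  rewrite addSn !yS opprD addrACA subrr add0r -mulrBr (le_trans (xle _)) //.
  by rewrite exprSr invfM mulrA ler_pM2r ?invr_gt0.
have /cauchy_cvg : cauchy (y n @[n --> \oo])%classic.
  apply: cauchy_exP => e e0.
  have [|N NE] := @halving_lt _ (`|1 : B| * 2) e _ e0; first by rewrite mulr_ge0.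
  exists (y N); exists N => // n /= Nn.
  rewrite -ball_normE /= distrC -(subnKC Nn).
  exact: le_lt_trans (y_cauchy _ _) NE.
move=> /cvg_ex [l yl].
have l_near e : 0 < e -> exists n, `|l - y n| < e /\ `|l - y n.+1| < e.
  move=> e0; have [N _ Nl] := ((cvgrPdist_lt _ _).1 yl) e e0.
  exists N; split; apply: Nl => //=; exact: leqnSn.
have fix_l (h : B -> B) : (forall z, `|h l - h z| <= `|l - z|) ->
    (forall n, h (y n) = y n.+1) -> h l = l.
  move=> hle hy; apply/eqP; rewrite -subr_eq0 -normr_le0.
  apply/ler_addgt0Pr => e e0; rewrite add0r.
  have [n [ln ln1]] := l_near (e / 2) (divr_gt0 e0 (ltr0Sn _ 1)).
  rewrite -(subrK (h (y n)) (h l)) -addrA (le_trans (ler_normD _ _)) //.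
  rewrite [e]splitr lerD ?(le_trans (hle _)) ?ltW //.
  by rewrite hy distrC.
have half_le (z : B) : `|z| / 2 <= `|z|.
  by rewrite ler_pdivrMr // ler_peMr // ler1n.
have fixl : 1 + x * l = l.
  apply: (fix_l (fun z => 1 + x * z)) => // z.
  rewrite opprD addrACA subrr add0r -mulrBr.
  exact: le_trans (xle _) (half_le _).
have fixr : 1 + l * x = l.
  apply: (fix_l (fun z => 1 + z * x)) => [z|n]; last by rewrite -yC.
  rewrite opprD addrACA subrr add0r -mulrBl.
  apply: le_trans (normrM_le _ _) (le_trans _ (half_le _)).
  by rewrite ler_wpM2l.
exists l; split.
  by rewrite mulrBl mul1r -{1}fixl addrK.
by rewrite mulrBr mulr1 -{1}fixr addrK.
Qed.

(** * Approximation of inessential elements by invertible ones *)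

Lemma near_not_limit_point (R : realType) (S : set R[i]^o) (z e : R[i]) :
  0 < e -> ~ limit_point S z -> exists w : R[i], `|w - z| < e /\ ~ S w.
Proof.
move=> e0 zS; apply: contrapT => nw; apply: zS => U zU.
have Ball_U : nbhs (z : R[i]^o) (U `&` ball (z : R[i]^o) e)%classic.
  by apply: filterI => //; exact: nbhsx_ballx.
have [d /= d0 dU] := (nbhs_ballP _ _).1 Ball_U.
have [|Uw zw] := dU (z + d / 2).
  rewrite -ball_normE /= opprD addNKr normrN gtr0_norm ?divr_gt0 //.
  by rewrite ltr_pdivrMr // ltr_pMr // ltr1n.
exists (z + d / 2); split=> //.
  by rewrite -subr_eq0 addrAC subrr add0r mulf_neq0 ?invr_neq0 ?pnatr_eq0 ?lt0r_neq0.
apply: contrapT => Sw; apply: nw; exists (z + d / 2); split=> //.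
by rewrite distrC; move: zw; rewrite -ball_normE.
Qed.

(** The sum of all inessential ideals, built one summand at a time: the
    approximation by invertible elements treats one inessential ideal per step. *)
Inductive ess_sum (R : realType) (A : banachAlgType R[i]) : A -> Prop :=
| ess_sum0 : ess_sum 0
| ess_sumD x y : ess_sum x -> inessential_radical y -> ess_sum (x + y).

Lemma radical_Ml (R : realType) (A : banachAlgType R[i]) (a x : A) :
  inessential_radical x -> inessential_radical (a * x).
Proof. by move=> [J iJ Jx]; exists J => //; case: iJ => -[_ _ + _] _; apply. Qed.

Lemma radical_Mr (R : realType) (A : banachAlgType R[i]) (a x : A) :
  inessential_radical x -> inessential_radical (x * a).
Proof. by move=> [J iJ Jx]; exists J => //; case: iJ => -[_ _ _ +] _; apply. Qed.

Lemma ess_sum_add (R : realType) (A : banachAlgType R[i]) (x y : A) :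
  ess_sum x -> ess_sum y -> ess_sum (x + y).
Proof.
move=> Kx; elim=> [|y1 y2 _ IH y2r]; first by rewrite addr0.
by rewrite addrA; constructor.
Qed.

Lemma ess_sum_Mr (R : realType) (A : banachAlgType R[i]) (x a : A) :
  ess_sum x -> ess_sum (x * a).
Proof.
elim=> [|y1 y2 _ IH y2r]; first by rewrite mul0r; constructor.
by rewrite mulrDl; constructor=> //; exact: radical_Mr.
Qed.

(** Let g = x + s be invertible with s small, and let y be inessential.  For a
    scalar w, x + y + (s + (w - 1) g) = g (w + g^-1 y).  Since - g^-1 y is
    inessential, 1 is not an accumulation point of its spectrum, so some w
    arbitrarily close to 1 makes the right-hand side invertible.  Correcting by a
    multiple of g rather than by a scalar is what lets the summands lie in
    different ideals. *)
Lemma ess_sum_closure (R : realType) (A : banachAlgType R[i]) (x : A) (e : R[i]) :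
  ess_sum x -> 0 < e -> exists s, `|s| < e /\ invertible (x + s).
Proof.
move=> Kx; elim: Kx e => [|{}x y _ IH yr] e e0.
  have n1 : 0 < `|1 : A| by rewrite normr_gt0 oner_neq0.
  (* The empty sum is approximated by scalar multiples of 1. *)
  pose w := e / 2 / `|1 : A|.
  have w0 : 0 < w by rewrite !divr_gt0.
  exists (w%:A); split.
    rewrite normrZ gtr0_norm // divfK ?gt_eqF //.
    by rewrite ltr_pdivrMr // ltr_pMr // ltr1n.
  rewrite add0r; exists (w^-1%:A).
  by split; rewrite -scalerAl mul1r scalerA ?mulfV ?mulVf ?scale1r ?gt_eqF.
have [s [se [g' [gg' g'g]]]] := IH (e / 2) (divr_gt0 e0 (ltr0Sn _ 1)).
set g := x + s in gg' g'g.
have g0 : 0 < `|g| + 1 by rewrite ltr_wpDl.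
have d0 : 0 < e / 2 / (`|g| + 1) by rewrite !divr_gt0.
have y1r : inessential_radical (- 1 * (g' * y)) by do 2 apply: radical_Ml.
have : ~ limit_point (spectrum (- 1 * (g' * y)) : set R[i]^o) 1.
  move=> l1; case: y1r => J [_ iJ] /iJ /(_ _ l1) /= /eqP.
  by rewrite oner_eq0.
move=> /(near_not_limit_point d0) [w [w1 /contrapT wi]].
exists (s + (w - 1) *: g); split.
  rewrite (le_lt_trans (ler_normD _ _)) // [e in _ < e]splitr ltrD //.
  rewrite normrZ (@le_lt_trans _ _ (`|w - 1| * (`|g| + 1))) //.
    by rewrite ler_wpM2l // lerDl.
  by rewrite -ltr_pdivlMr.
have -> : x + y + (s + (w - 1) *: g) = g * (w%:A - -1 * (g' * y)).
  rewrite mulrBr mulN1r mulrN opprK mulrA gg' mul1r -scalerAr mulr1.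
  rewrite addrACA -/g scalerBl scale1r [y + _]addrC addrA.
  by rewrite [g + (_ - _)]addrC subrK.
by apply: invertibleM => //; exists g'.
Qed.

(** * Descent of inverses from B to A *)

Lemma embedding_reflects_units (R : realType) (A B : banachAlgType R[i])
    (iota : {lrmorphism A -> B}) :
  injective iota -> inverse_closed iota -> reflects_units iota.
Proof.
move=> inj ic a [b ab]; have [a' _ a'b] := ic a b ab.
exists a'; case: ab; rewrite -a'b -!rmorphM -(rmorph1 iota).
by move=> /inj aa' /inj a'a.
Qed.

(** An element that is small in A is small in B, where the Neumann series gives
    invertibility of 1 + b iota(s). *)
Lemma ess_sum_perturb (R : realType) (A B : banachAlgType R[i])
    (iota : {lrmorphism A -> B}) (x : A) (b : B) :
  continuously_embedded iota -> ess_sum x ->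
  exists s, invertible (x + s) /\ invertible (1 + b * iota s).
Proof.
move=> [J J0 iotaJ] Kx; have Jc : 0 < J%:C%C by rewrite ltcR.
have b0 : 0 < `|b| + 1 by rewrite ltr_wpDl.
have e0 : 0 < 2^-1 / (`|b| + 1) / J%:C%C by rewrite !divr_gt0 ?invr_gt0.
have [s [se xs]] := ess_sum_closure Kx e0; exists s; split=> //.
rewrite -[b * _]opprK; apply: neumann_invertible.
rewrite normrN (le_trans (normrM_le _ _)) //.
apply: (@le_trans _ _ ((`|b| + 1) * (J%:C%C * `|s|))).
  by apply: ler_pM => //; rewrite lerDl.
by rewrite mulrC -ler_pdivlMr // mulrC -ler_pdivlMr // ltW.
Qed.

Lemma rev_ess_upper (R : realType) (A : banachAlgType R[i]) (n : nat)
    (T : 'M[A]_n) (r := perm rev_ord_inj) :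
  ess_lower T -> ess_upper (row_perm r (col_perm r T)).
Proof.
move=> Tl j k kj; rewrite !mxE !permE; apply: Tl.
by rewrite /= ltn_sub2lE // ltnS.
Qed.

Unset Implicit Arguments.

Theorem theorem6 (R : realType) (A B : banachAlgType R[i])
    (iota : {lrmorphism A -> B})
    (iota_inj : injective iota)
    (A_inverse_closed : inverse_closed iota)
    (A_embedded : continuously_embedded iota)
    (n : nat) (n_ge1 : (1 <= n)%N)
    (T : 'M[A]_n) (T_ess : ess_upper T \/ ess_lower T)
    (S : 'M[B]_n) (TS_inv : is_inverse (map_mx iota T) S) :
  exists S' : 'M[A]_n, map_mx iota S' = S.
Proof.
have upper (T' : 'M[A]_n) :
    ess_upper T' -> invertible (map_mx iota T') -> invertible T'.
  case: n n_ge1 T' {T T_ess S TS_inv} => // n _ T' T'u.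
  apply: (reflects_units_upper_triangular
    (embedding_reflects_units iota_inj _) (@ess_sum_add R A)) => //.
  - by move=> x a; exact: ess_sum_Mr.
  - by move=> x b; exact: ess_sum_perturb.
  - move=> i j ji; rewrite -[T' i j]add0r.
    by constructor; [constructor|exact: T'u].
have [S' [TS' S'T]] : invertible T.
  have iT : invertible (map_mx iota T) by exists S.
  case: T_ess => [/upper|/rev_ess_upper/upper]; first exact.
  rewrite map_row_perm map_col_perm => H.
  apply/(invertible_col_perm (perm rev_ord_inj)).
  apply/(invertible_row_perm (perm rev_ord_inj))/H.
  by apply/invertible_row_perm/invertible_col_perm.
exists S'; apply: is_inverse_unique TS_inv.
by split; rewrite -[_ * _]map_mxM -?[_ *m _]/(_ * _) ?TS' ?S'T map_mx1.
Qed.
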